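(* Let $P$ be a finite bounded graded rank-uniform poset of rank $3$. If its atoms can be ordered as $(x_1,x_2,\ldots,x_n)$ so that $$0<|\operatorname{icov}(x_2)|\leq|\operatorname{icov}(x_3)|\leq\cdots\leq|\operatorname{icov}(x_n)|,$$ then $P$ is UMEL-shellable.
   Context: Let $P$ be a finite graded bounded poset with rank function $\mathrm{rk}$, minimum $\hat 0$ and maximum $\hat 1$. Write $s\lessdot t$ if $t$ covers $s$, and let $\mathcal{E}(P)$ be the set of pairs $(s,t)$ with $s\lessdot t$. Atoms are the elements of rank $1$. Rank-uniform poset (no labeling): for $s\in P$ and $k\ge 0$, $W_k(s)$ is the number of elements of rank $k+\mathrm{rk}(s)$ that are above $s$ (i.e. $\geqslant s$). $P$ is rank-uniform if $W_k(s)=W_k(t)$ for all $s,t\in P$ of the same rank and all positive integers $k$. The set $\operatorname{icov}(x_i)$: given an ordering $(x_1,\dots,x_n)$ of all the atoms of $P$ (rank $3$), for $i\ge 2$, $\operatorname{icov}(x_i)$ is the set of rank-$2$ elements $y$ covering $x_i$ that also cover at least one earlier atom $x_j$ with $j<i$ (equivalently, the covers of $x_i$ that are already present when the atoms $x_1,\dots,x_{i-1}$ and all of their covers have been inserted). An edge labeling is a map $\lambda:\mathcal{E}(P)\to\Lambda$, where $\Lambda$ is a totally ordered set (order $\vartriangleleft$). A maximal chain $s=u_0\lessdot u_1\lessdot\cdots\lessdot u_k=t$ of the interval $[s,t]$ has label word $\lambda(u_0,u_1)\cdots\lambda(u_{k-1},u_k)$. EL-labeling: $\lambda$ is an EL-labeling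 if for all $s\leqslant t$ in $P$ there is a unique maximal chain of $[s,t]$ whose label word is weakly increasing (as the rank increases), and this chain's label word is lexicographically minimal among the label words of all maximal chains of $[s,t]$. An EL-labeled poset is a pair $(P,\lambda)$ with $\lambda$ an EL-labeling. For an EL-labeled poset $(P,\lambda)$ and $s\in P$, let $\lambda_1\vartriangleleft\cdots\vartriangleleft\lambda_\ell$ be the distinct labels of the covering relations $s\lessdot t$ above $s$. - Width: $\omega_s(i)=|\{t: s\lessdot t,\ \lambda(s,t)=\lambda_i\}|$ for $1\le i\le\ell$, and $\omega_s(i)=0$ for $i>\ell$. - Index: for $s\lessdot t$, $\mathrm{Ind}(s,t)$ is the unique $i\in[\ell]$ with $\lambda_i=\lambda(s,t)$. - Descents: for $s\lessdot t$, if $\lambda'_1\vartriangleleft\cdots\vartriangleleft\lambda'_{\ell'}$ are the distinct labels of the covering relations above $t$, then $\mathrm{des}_s(t)=|\{j\in[\ell']:\lambda'_j\vartriangleleft\lambda(s,t)\}|$. Rank-uniform labeled poset: an EL-labeled poset $(P,\lambda)$ such that (uniform width) $\omega_s(i)=\omega_{s'}(i)$ for all $s,s'$ of the same rank and all $i\ge1$, and (uniform descent) $\mathrm{des}_s(t)=\mathrm{des}_{s'}(t')$ whenever $s,s'$ have the same rank, $s\lessdot t$, $s'\lessdot t'$ and $\mathrm{Ind}(s,t)=\mathrm{Ind}(s',t')$. Monotonic: for a rank-uniform labeled poset and $0\le k\le \mathrm{rk}(P)-1$, let $\ell_k$ be the number of distinct labels above any element of rank $k$, and for $i\in[\ell_k]$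 let $\mathrm{des}_k(i)$ be the common value of $\mathrm{des}_s(t)$ over all $s\lessdot t$ with $\mathrm{rk}(s)=k$, $\mathrm{Ind}(s,t)=i$. The labeled poset is monotonic if for every such $k$ the function $\mathrm{des}_k$ is weakly increasing on $[\ell_k]$. UMEL-shellable: $P$ is UMEL-shellable if it admits an EL-labeling $\lambda$ such that $(P,\lambda)$ is a monotonic rank-uniform labeled poset. *)

(* Defs.v *)
From HB Require Import structures.
From mathcomp Require Import all_boot all_order.
Set Implicit Arguments.
Unset Strict Implicit.
Unset Printing Implicit Defensive.
Import Order.TTheory.
Local Open Scope order_scope.

Definition covers (d : Order.disp_t) (P : finPOrderType d) (s t : P) : bool :=
  (s < t) && [forall u : P, ~~ (s < u < t)].

Definition is_rank_function (d : Order.disp_t) (P : finTBPOrderType d)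
    (rk : P -> nat) : Prop :=
  rk \bot = 0%N /\ forall s t : P, covers s t -> rk t = (rk s).+1.

Section RankUniformPoset.
Variables (d : Order.disp_t) (P : finTBPOrderType d) (rk : P -> nat).

Definition whitney (k : nat) (s : P) : nat :=
  #|[set u : P | (s <= u) && (rk u == (k + rk s)%N)]|.

Definition rank_uniform : Prop :=
  forall s t : P, rk s = rk t ->
  forall k : nat, (0 < k)%N -> whitney k s = whitney k t.

Definition is_atom_ordering (n : nat) (x : n.-tuple P) : Prop :=
  uniq x /\ forall a : P, (a \in x) = (rk a == 1%N).

(* Indices are shifted: the ordering (x_1, ..., x_n) is the tuple x with
   x_(i+1) = tnth x i. *)
Definition icov (n : nat) (x : n.-tuple P) (i : 'I_n) : {set P} :=
  [set y : P | [&& rk y == 2%N, covers (tnth x i) y &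
                   [exists j : 'I_n, (j < i)%N && covers (tnth x j) y]]].

End RankUniformPoset.

(* An edge labeling E(P) -> Lambda is represented by a function on all pairs,
   of which only the values at pairs (s, t) with covers s t are ever used. *)
Section EdgeLabeling.
Variables (d : Order.disp_t) (P : finTBPOrderType d).
Variables (dL : Order.disp_t) (L : orderType dL) (lam : P -> P -> L).

(* The chain s = u_0 < u_1 < ... < u_k = t is represented by s together with
   the sequence c = [:: u_1; ...; u_k]. *)
Definition maximal_chain (s t : P) (c : seq P) : bool :=
  path (@covers d P) s c && (last s c == t).

Definition label_word (s : P) (c : seq P) : seqlexi L := pairmap lam s c.

Definition increasing_chain (s : P) (c : seq P) : bool :=
  sorted <=%O (label_word s c : seq L).

(* <= on label words is the lexicographic order, through the alias seqlexi. *)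
Definition EL_labeling : Prop :=
  forall s t : P, s <= t ->
  exists c : seq P,
    [/\ maximal_chain s t c,
        increasing_chain s c,
        forall c' : seq P,
          maximal_chain s t c' -> increasing_chain s c' -> c' = c
      & forall c' : seq P,
          maximal_chain s t c' -> label_word s c <= label_word s c'].

Definition labels_above (s : P) : seq L :=
  sort <=%O (undup [seq lam s t | t <- enum P & covers s t]).

(* For i >= 1, the i-th label is [onth (labels_above s) i.-1], which is None
   past the number of labels. *)
Definition width (s : P) (i : nat) : nat :=
  #|[set t : P | covers s t &
       onth (labels_above s) i.-1 == Some (lam s t)]|.

Definition Ind (s t : P) : nat := (index (lam s t) (labels_above s)).+1.

Definition des (s t : P) : nat :=
  count (fun l : L => l < lam s t) (labels_above t).

Variable rk : P -> nat.

Definition uniform_width : Prop :=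
  forall s s' : P, rk s = rk s' ->
  forall i : nat, (1 <= i)%N -> width s i = width s' i.

Definition uniform_descent : Prop :=
  forall s s' t t' : P, rk s = rk s' -> covers s t -> covers s' t' ->
  Ind s t = Ind s' t' -> des s t = des s' t'.

Definition rank_uniform_labeled : Prop :=
  [/\ EL_labeling, uniform_width & uniform_descent].

(* The next two are the values common to all admissible s, resp. (s, t), when
   the labeled poset is rank-uniform; they are read off an arbitrary one. *)
Definition num_labels_at_rank (k : nat) : nat :=
  if [pick s : P | rk s == k] is Some s then size (labels_above s) else 0%N.

Definition des_at_rank (k i : nat) : nat :=
  if [pick e : P * P | [&& covers e.1 e.2, rk e.1 == k & Ind e.1 e.2 == i]]
  is Some e then des e.1 e.2 else 0%N.

Definition monotonic : Prop :=
  forall k : nat, (k < rk \top)%N ->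
  forall i j : nat, (1 <= i)%N -> (i <= j)%N -> (j <= num_labels_at_rank k)%N ->
  (des_at_rank k i <= des_at_rank k j)%N.

End EdgeLabeling.

Definition UMEL_shellable (d : Order.disp_t) (P : finTBPOrderType d)
    (rk : P -> nat) : Prop :=
  exists (dL : Order.disp_t) (L : orderType dL) (lam : P -> P -> L),
    rank_uniform_labeled lam rk /\ monotonic lam rk.

(* Main.v *)
Require Import Defs.
From mathcomp Require Import all_boot all_order.

Set Implicit Arguments.
Unset Strict Implicit.
Unset Printing Implicit Defensive.
Import Order.TTheory.

(** Take natural numbers as labels, number the atoms from [0], and write [N]
    for the number of elements of [P].  Label the edge from the bottom to the
    atom number [i] by [i * N].  Above that atom, label the coatoms of its icov
    set [0, 1, 2, ...], and give its other covers distinct labels that are at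
    least [i * N].  Label every edge to the top by [0].  A cover of the atom is
    thus in the icov set exactly when its label is below [i * N].

    The labeling is EL for the following reasons.  Below a coatom [y], the
    earliest atom under [y] is the only one for which [y] is not in the icov
    set, hence the only one that does not give a descent; it is also the one
    with the smallest first label.  A chain that ends at the top has last label
    [0], so it increases only if all its labels are [0].  Above each atom there
    is exactly one edge labeled [0]: for the first atom the icov set is empty
    and the other labels start at [0], while for the later atoms this is where
    non-emptiness of the icov set is needed.  Among the atoms themselves only
    the first one has label [0].

    The edges above any given element have distinct labels.  All widths are
    therefore [0] or [1], and they are uniform because elements of the same rank
    have equally many covers.  Moreover [Ind], up to a shift, and [des] just
    count edges with a smaller label.  At the bottom, [des] of the atom number
    [i] is the size of its icov set, which is weakly increasing by assumption;
    at an atom, [des] is [0] on the edge labeled [0] and [1] on the others; at a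
    coatom it is [0].  In each rank [des] is thus a monotone function of [Ind], which yields both
    uniformity and monotonicity ([uniform_monotonic]). *)

(** * Labelings with distinct labels above each element *)

Section DistinctLabels.
Variables (d : Order.disp_t) (P : finTBPOrderType d).
Variables (dL : Order.disp_t) (L : orderType dL) (lam : P -> P -> L).
Local Open Scope order_scope.

Definition distinct_labels : Prop :=
  forall s t u : P, covers s t -> covers s u -> lam s t = lam s u -> t = u.

Lemma index_sorted (l : seq L) (v : L) :
  sorted <%O l -> v \in l -> index v l = count (fun w => w < v) l.
Proof.
elim: l => //= y l IHl path_l; rewrite inE.
have y_min : all (fun w => y < w) l.
  by move: path_l; rewrite lt_path_sortedE => /andP[].
case: eqVneq => [-> _ | ne_vy] /=.
  rewrite ltxx; apply/esym/eqP; rewrite -leqn0 leqNgt -has_count -all_predC.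
  by apply: sub_all y_min => w /= /lt_gtF ->.
move=> lv; rewrite (allP y_min) // IHl //.
exact: path_sorted path_l.
Qed.

Lemma sorted_labels_above (s : P) : sorted <%O (labels_above lam s).
Proof. by rewrite sort_lt_sorted undup_uniq. Qed.

Lemma mem_labels_above (s : P) (v : L) :
  reflect (exists2 t, covers s t & v = lam s t) (v \in labels_above lam s).
Proof.
rewrite mem_sort mem_undup; apply: (iffP mapP) => [[t]|[t st ->]].
  by rewrite mem_filter => /andP[st _] ->; exists t.
by exists t; rewrite // mem_filter st mem_enum.
Qed.

Hypothesis lam_distinct : distinct_labels.

Lemma count_labels_above (s : P) (a : pred L) :
  count a (labels_above lam s) = #|[set t | covers s t & a (lam s t)]|.
Proof.
rewrite (permP (permEl (perm_sort _ _))) undup_id; last first.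
  rewrite map_inj_in_uniq ?filter_uniq -?enumT ?enum_uniq // => t u.
  by rewrite !mem_filter => /andP[st _] /andP[su _]; apply: lam_distinct.
rewrite count_map count_filter cardsE cardE enumT /enum_mem size_filter.
by apply: eq_count => t; rewrite /= andbC.
Qed.

Lemma IndE (s t : P) : covers s t ->
  Ind lam s t = #|[set u | covers s u & lam s u < lam s t]|.+1.
Proof.
move=> st; rewrite /Ind index_sorted ?sorted_labels_above //.
  by rewrite count_labels_above.
by apply/mem_labels_above; exists t.
Qed.

Lemma desE (s t : P) :
  des lam s t = #|[set u | covers t u & lam t u < lam s t]|.
Proof. exact: count_labels_above. Qed.

Lemma size_labels_above (s : P) :
  size (labels_above lam s) = #|[set t | covers s t]|.
Proof.
rewrite -(count_predT (labels_above lam s)) count_labels_above.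
by apply: eq_card => t; rewrite !inE andbT.
Qed.

Lemma cover_of_Ind (s : P) (i : nat) : (i < size (labels_above lam s))%N ->
  exists t, [/\ covers s t, Ind lam s t = i.+1
              & onth (labels_above lam s) i = Some (lam s t)].
Proof.
move=> lt_i; case def_v: (onth _ i) => [v|]; last first.
  by move: lt_i; rewrite -onthTE def_v.
have vE : nth v (labels_above lam s) i = v by exact: onth_nth def_v.
have [t st vt] : exists2 t, covers s t & v = lam s t.
  by apply/mem_labels_above; rewrite -vE mem_nth.
exists t; split; rewrite -?vt //; congr _.+1.
by rewrite -vt -vE index_uniq // (lt_sorted_uniq (sorted_labels_above s)).
Qed.

(** Since [i] is shifted, a label of index [i] exists exactly when [i] is less
    than the number of covers, and then a single cover carries it. *)
Lemma width_distinct (s : P) (i : nat) :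
  width lam s i.+1 = (i < #|[set t | covers s t]|)%N.
Proof.
rewrite -size_labels_above /width /=.
case: ltnP => [/cover_of_Ind[t [st _ ->]] | ge_i].
  apply/eqP/cards1P; exists t; apply/setP=> u; rewrite !inE.
  apply/andP/eqP => [[su /eqP[]] | ->]; last by rewrite eqxx.
  by move/(lam_distinct st su).
by rewrite onth_default //; apply: eq_card0 => u; rewrite !inE andbF.
Qed.

(** Comparing [des] for two edges with comparable [Ind] handles two conditions
    at once: applied in both directions to edges of equal [Ind] it gives uniform
    descent, and applied to representatives of two indices it gives
    monotonicity. *)
Lemma uniform_monotonic (rk : P -> nat) :
  EL_labeling lam ->
  (forall s s', rk s = rk s' ->
     #|[set t | covers s t]| = #|[set t | covers s' t]|) ->
  (forall s s' t t' : P, rk s = rk s' -> covers s t -> covers s' t' ->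
     (Ind lam s t <= Ind lam s' t')%N -> (des lam s t <= des lam s' t')%N) ->
  rank_uniform_labeled lam rk /\ monotonic lam rk.
Proof.
move=> lamEL deg_rk des_mono; split; first split=> //.
- by move=> s s' rk_s [//|i] _; rewrite !width_distinct (deg_rk _ _ rk_s).
- move=> s s' t t' rk_s st st' IndE; apply/eqP; rewrite eqn_leq.
  by rewrite !des_mono // IndE.
move=> k _ i j i_gt0 le_ij; rewrite /num_labels_at_rank.
case: pickP => [s /eqP rk_s le_j | _]; last first.
  by move/(leq_trans (leq_trans i_gt0 le_ij)).
rewrite /des_at_rank; case: pickP => [[s1 t1] /= | _ //].
case/and3P=> st1 /eqP rk_s1 /eqP Ind1.
have j_gt0 := leq_trans i_gt0 le_ij.
have [|t [st IndT _]] := @cover_of_Ind s j.-1; first by rewrite prednK.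
case: pickP => [[s2 t2] /= | /(_ (s, t))]; last first.
  by rewrite /= st rk_s IndT prednK ?eqxx.
case/and3P=> st2 /eqP rk_s2 /eqP Ind2.
by apply: des_mono; rewrite ?Ind1 ?Ind2 // rk_s1.
Qed.

End DistinctLabels.

(** * Chains and ranks *)

Section Graded.
Variables (d : Order.disp_t) (P : finTBPOrderType d) (rk : P -> nat).
Hypothesis rk_rank : is_rank_function rk.
Local Open Scope order_scope.

(** Refining at a point strictly between [s] and [t] leaves fewer points inside
    both halves. *)
Lemma maximal_chain_exists (s t : P) : s <= t -> exists c, maximal_chain s t c.
Proof.
have [m] := ubnP #|[set u | s < u < t]|; elim: m s t => // m IHm s t.
rewrite ltnS => le_m; rewrite le_eqVlt => /predU1P[-> | lt_st].
  by exists [::]; rewrite /maximal_chain /= eqxx.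
have [st | ] := boolP (covers s t).
  by exists [:: t]; rewrite /maximal_chain /= st eqxx.
rewrite /covers lt_st /= => /forallPn[u]; rewrite negbK => sut.
have /andP[su ut] := sut.
have smaller (v w : P) : s <= v -> w <= t -> (v == u) || (w == u) ->
    (#|[set z | (v < z < w)%O]| < m)%N.
  move=> sv wt vwu; apply: leq_trans le_m; apply: proper_card.
  apply/properP; split; last first.
    by exists u; rewrite !inE //; case/orP: vwu => /eqP ->; rewrite ltxx ?andbF.
  apply/subsetP=> z; rewrite !inE => /andP[vz zw].
  by rewrite (le_lt_trans sv vz) (lt_le_trans zw wt).
have [|c /andP[pc /eqP lc]] := IHm s u _ (ltW su).
  by apply: smaller; rewrite ?eqxx ?orbT // ltW.
have [|c' /andP[pc' /eqP lc']] := IHm u t _ (ltW ut).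
  by apply: smaller; rewrite ?eqxx // ltW.
by exists (c ++ c'); rewrite /maximal_chain cat_path last_cat lc pc pc' lc' /=.
Qed.

Lemma maximal_chain_rk (s t : P) (c : seq P) :
  maximal_chain s t c -> rk t = (rk s + size c)%N.
Proof.
case/andP=> + /eqP <-; elim: c s => [|u c IHc] s /=; first by rewrite addn0.
by case/andP=> su /IHc ->; rewrite (rk_rank.2 _ _ su) addnS.
Qed.

Lemma rk_le (s t : P) : s <= t -> (rk s <= rk t)%N.
Proof.
by case/maximal_chain_exists=> c /maximal_chain_rk ->; apply: leq_addr.
Qed.

Lemma rk_inj (s t : P) : s <= t -> rk s = rk t -> s = t.
Proof.
case/maximal_chain_exists=> c mc /eqP; rewrite (maximal_chain_rk mc).
rewrite -{1}[rk s]addn0 eqn_add2l eq_sym => /nilP c0.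
by move: mc; rewrite c0 => /eqP.
Qed.

Lemma coversE (s t : P) : covers s t = (s <= t) && (rk t == (rk s).+1).
Proof.
apply/idP/andP => [st | [/maximal_chain_exists[c mc]]].
  by rewrite (rk_rank.2 _ _ st); case/andP: st => /ltW.
rewrite (maximal_chain_rk mc) -addn1 eqn_add2l.
by case: c mc => [|u [|v c]] // /andP[/= /andP[su _] /eqP <-].
Qed.

Lemma card_covers (s : P) : #|[set t | covers s t]| = whitney rk 1 s.
Proof. by apply: eq_card => t; rewrite !inE coversE add1n. Qed.

Lemma rk_eq0 (s : P) : (rk s == 0%N) = (s == \bot).
Proof.
apply/eqP/eqP => [s0 | ->]; last exact: rk_rank.1.
by apply/esym/rk_inj; rewrite ?le0x // rk_rank.1.
Qed.

Lemma rk_eq_top (s : P) : (rk s == rk \top) = (s == \top).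
Proof.
by apply/eqP/eqP => [/rk_inj -> | ->] //; rewrite lex1.
Qed.

End Graded.

(** * The EL condition on short intervals *)

Section ShortIntervals.
Variables (d : Order.disp_t) (P : finTBPOrderType d).
Variables (dL : Order.disp_t) (L : orderType dL) (lam : P -> P -> L).
Variable rk : P -> nat.
Hypothesis rk_rank : is_rank_function rk.
Local Open Scope order_scope.

Definition EL_interval (s t : P) : Prop :=
  exists c : seq P,
    [/\ maximal_chain s t c,
        increasing_chain lam s c,
        forall c' : seq P,
          maximal_chain s t c' -> increasing_chain lam s c' -> c' = c
      & forall c' : seq P,
          maximal_chain s t c' -> label_word lam s c <= label_word lam s c'].

Lemma maximal_chain_size (s t : P) (c c' : seq P) :
  maximal_chain s t c -> maximal_chain s t c' -> size c' = size c.
Proof.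
move=> /(maximal_chain_rk rk_rank) rkt /(maximal_chain_rk rk_rank).
by rewrite rkt => /eqP; rewrite eqn_add2l => /eqP.
Qed.

Lemma EL_interval_refl (s : P) : EL_interval s s.
Proof.
have mc : maximal_chain s s [::] by rewrite /maximal_chain /= eqxx.
by exists [::]; split=> // c' /(maximal_chain_size mc) /eqP/nilP.
Qed.

Lemma EL_interval_cover (s t : P) : covers s t -> EL_interval s t.
Proof.
move=> st; have mc : maximal_chain s t [:: t].
  by rewrite /maximal_chain /= st eqxx.
have uniq_c c : maximal_chain s t c -> c = [:: t].
  move=> mc'; have sz := maximal_chain_size mc mc'.
  by case: c sz mc' => [|u []] // _ /andP[_ /= /eqP ->].
exists [:: t]; split=> // c /uniq_c -> //.
Qed.

(** In length two it suffices that one middle element gives an increasing word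
    with a strictly smaller first label than all the others, and that these all
    give strict descents: the comparison of first labels settles the
    lexicographic order. *)
Lemma EL_interval_diamond (s t u0 : P) :
  covers s u0 -> covers u0 t -> lam s u0 <= lam u0 t ->
  (forall u, covers s u -> covers u t -> u != u0 ->
     lam s u0 < lam s u /\ lam u t < lam s u) ->
  EL_interval s t.
Proof.
move=> su0 u0t le0 gt0.
have mc : maximal_chain s t [:: u0; t].
  by rewrite /maximal_chain /= su0 u0t eqxx.
have chainE c : maximal_chain s t c ->
    exists u, [/\ c = [:: u; t], covers s u & covers u t].
  move=> mc'; have sz := maximal_chain_size mc mc'.
  case: c sz mc' => [|u [|v []]] // _ /andP[/= /and3P[su uv _] /eqP vt].
  by exists u; rewrite -vt.
exists [:: u0; t]; split=> //.
- by rewrite /increasing_chain /= le0.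
- move=> _ /chainE[u [-> su ut]]; rewrite /increasing_chain /= andbT.
  have [-> //|ne] := eqVneq u u0.
  by have [_ ut_lt] := gt0 u su ut ne; rewrite leNgt ut_lt.
move=> _ /chainE[u [-> su ut]]; have [-> //|ne] := eqVneq u u0.
have [lt_u _] := gt0 u su ut ne.
by rewrite /label_word /= lexi_cons (ltW lt_u) leNgt lt_u.
Qed.

End ShortIntervals.

(** * The labeling *)

Section Labeling.
Variables (d : Order.disp_t) (P : finTBPOrderType d) (rk : P -> nat).
Variables (n : nat) (x : n.-tuple P).

(** The set icov, indexed by the atom instead of its position.  Its elements
    are the covers of [a] whose earliest atom, located by [find], precedes [a];
    this makes the earliest atom below a coatom directly accessible. *)
Definition shared (a : P) : {set P} :=
  [set y | covers a y & find (fun b => covers b y) x < index a x].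

(** The index in [enum (shared s)] is less than [#|P|] and hence than the label
    of [s] itself, except for the first atom, whose shared set is empty.  The
    other covers are indexed among all covers, so that on the first atom their
    labels start at [0]. *)
Definition icov_label (s t : P) : nat :=
  if s == \bot%O then index t x * #|P|
  else if s \in x then
    if t \in shared s then index t (enum (shared s))
    else index s x * #|P| + index t (enum [set y | covers s y])
  else 0.

Hypotheses (rk_rank : is_rank_function rk) (rk3 : rk (\top)%O = 3).
Hypothesis x_atoms : is_atom_ordering rk x.
Hypothesis icov_x2_gt0 : forall i : 'I_n, i = 1 :> nat -> 0 < #|icov rk x i|.
Hypothesis icov_le : forall i j : 'I_n, 0 < i -> i <= j ->
  #|icov rk x i| <= #|icov rk x j|.

Lemma mem_atoms (a : P) : (a \in x) = (rk a == 1).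
Proof. exact: x_atoms.2. Qed.

Lemma atom_neq_bot (a : P) : a \in x -> a == \bot%O = false.
Proof. by rewrite mem_atoms -(rk_eq0 rk_rank) => /eqP ->. Qed.

Lemma covers_bot (a : P) : covers \bot%O a = (a \in x).
Proof. by rewrite (coversE rk_rank) le0x rk_rank.1 mem_atoms. Qed.

Lemma label_bot (a : P) : icov_label \bot%O a = index a x * #|P|.
Proof. by rewrite /icov_label eqxx. Qed.

Lemma label_atom (a y : P) : a \in x -> icov_label a y =
  if y \in shared a then index y (enum (shared a))
  else index a x * #|P| + index y (enum [set z | covers a z]).
Proof. by move=> ax; rewrite /icov_label (atom_neq_bot ax) ax. Qed.

Lemma label_top (y : P) : rk y = 2 -> icov_label y \top%O = 0.
Proof. by move=> y2; rewrite /icov_label -(rk_eq0 rk_rank) mem_atoms y2. Qed.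

Lemma icovE (i : 'I_n) : icov rk x i = shared (tnth x i).
Proof.
have idx : index (tnth x i) x = i.
  by rewrite (tnth_nth \bot%O) index_uniq ?size_tuple // x_atoms.1.
apply/setP=> y; rewrite !inE idx.
have [ay|]/= := boolP (covers _ y); last by rewrite andbF.
have -> : rk y == 2.
  have := mem_tnth i x; rewrite mem_atoms => /eqP a1.
  by rewrite (rk_rank.2 _ _ ay) a1.
apply/existsP/idP => [[j /andP[lt_ji jy]] | lt_i].
  apply: leq_ltn_trans lt_ji; rewrite leqNgt; apply/negP => lt_j.
  by have := before_find \bot%O lt_j; rewrite -tnth_nth jy.
have lt_n := ltn_trans lt_i (ltn_ord i).
exists (Ordinal lt_n); rewrite /= lt_i (tnth_nth \bot%O) /=.
by apply: (@nth_find _ _ (fun b => covers b y)); rewrite has_find size_tuple.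
Qed.

Lemma shared_first (a : P) : index a x = 0 -> shared a = set0.
Proof. by move=> a0; apply/setP=> y; rewrite !inE a0 andbF. Qed.

Lemma shared_atom (a : P) : a \in x -> exists2 i : 'I_n, i = index a x :> nat
  & shared a = icov rk x i.
Proof.
move=> ax; have lt_n : index a x < n.
  by rewrite -[n in _ < n](size_tuple x) index_mem.
exists (Ordinal lt_n) => //.
by rewrite icovE (tnth_nth \bot%O) nth_index.
Qed.

Lemma shared_mono (a b : P) : a \in x -> b \in x -> index a x <= index b x ->
  #|shared a| <= #|shared b|.
Proof.
move=> ax bx; have [/shared_first -> _ | a_gt0] := posnP (index a x).
  by rewrite cards0.
have [i iE ->] := shared_atom ax; have [j jE ->] := shared_atom bx.
by move=> ij; apply: icov_le; rewrite iE ?jE.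
Qed.

Lemma shared_gt0 (a : P) : a \in x -> 0 < index a x -> 0 < #|shared a|.
Proof.
move=> /shared_atom[i <- ->] i_gt0.
pose i1 := Ordinal (leq_ltn_trans i_gt0 (ltn_ord i)).
have /leq_trans := icov_x2_gt0 (erefl : i1 = 1 :> nat); apply.
exact: icov_le.
Qed.

Lemma label_shared (a y : P) : a \in x -> y \in shared a ->
  icov_label a y < index a x * #|P|.
Proof.
move=> ax ya; rewrite label_atom // ya.
have a_gt0 : 0 < index a x.
  by move: ya; rewrite inE => /andP[_]; apply: leq_ltn_trans.
apply: (@leq_trans #|P|); last by rewrite leq_pmull.
apply: (@leq_trans #|shared a|); last exact: max_card.
by rewrite cardE index_mem mem_enum.
Qed.

Lemma label_fresh (a y : P) : a \in x -> y \notin shared a ->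
  index a x * #|P| <= icov_label a y.
Proof.
move=> ax /negbTE ya; rewrite label_atom // ya.
exact: leq_addr.
Qed.

Lemma label_lt (a y : P) : a \in x ->
  (icov_label a y < index a x * #|P|) = (y \in shared a).
Proof.
move=> ax.
have [/(label_shared ax) // | /(label_fresh ax)] := boolP (y \in shared a).
by rewrite ltnNge => ->.
Qed.

(** The zero label is carried by the first cover when [a] is the first atom, and
    by the first element of [shared a] otherwise. *)
Lemma zero_label_exists (a : P) : a \in x ->
  exists2 y, covers a y & icov_label a y = 0.
Proof.
move=> ax; have [a0 | a_gt0] := posnP (index a x).
  have [c mc] := maximal_chain_exists (lex1 a).
  have [y ay] : exists y, covers a y.
    have := maximal_chain_rk rk_rank mc; rewrite rk3.
    have /eqP -> : rk a == 1 by rewrite -mem_atoms.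
    by case: c mc => // y c /andP[/= /andP[ay _] _] _; exists y.
  case def_e: (enum [set y | covers a y]) => [|z e].
    have : y \in enum [set y | covers a y] by rewrite mem_enum inE.
    by rewrite def_e.
  have az : covers a z.
    have : z \in enum [set y | covers a y] by rewrite def_e mem_head.
    by rewrite mem_enum inE.
  by exists z => //; rewrite label_atom // shared_first // inE def_e a0 /= eqxx.
have := shared_gt0 ax a_gt0; rewrite cardE.
case def_e: (enum (shared a)) => [//|z e] _.
have za : z \in shared a.
  have : z \in enum (shared a) by rewrite def_e mem_head.
  by rewrite mem_enum.
exists z; first by move: za; rewrite inE => /andP[].
by rewrite label_atom // za def_e /= eqxx.
Qed.

Lemma index_enum_inj (A : {set P}) (u v : P) : u \in A -> v \in A ->
  index u (enum A) = index v (enum A) -> u = v.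
Proof.
move=> uA vA e; rewrite -(nth_index u (s := enum A) (x := u)) ?mem_enum //.
by rewrite e nth_index ?mem_enum.
Qed.

Lemma covers_cases (s t : P) : covers s t ->
  [\/ s = \bot%O /\ t \in x, s \in x /\ rk t = 2 | rk s = 2 /\ t = \top%O].
Proof.
move=> st; have rkt := rk_rank.2 _ _ st.
have := rk_le rk_rank (lex1 t); rewrite rkt rk3 ltnS !mem_atoms rkt.
case s_rk: (rk s) => [|[|[|]]] // _.
- by constructor 1; split=> //; apply/eqP; rewrite -(rk_eq0 rk_rank) s_rk.
- by constructor 2.
constructor 3; split=> //.
by apply/eqP; rewrite -(rk_eq_top rk_rank) rkt s_rk rk3.
Qed.

Lemma icov_label_distinct : distinct_labels icov_label.
Proof.
move=> s t u st su.
have [[s0 tx]|[sx _]|[s2 ->]] := covers_cases st.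
- rewrite s0 !label_bot => /eqP; rewrite eqn_pmul2r; last first.
    by apply/card_gt0P; exists t.
  have ux : u \in x by rewrite -covers_bot -s0.
  by move=> /eqP e; rewrite -(nth_index t tx) e nth_index.
- have [ts | ts] := boolP (t \in shared s);
  have [us | us] := boolP (u \in shared s).
  + rewrite !label_atom // ts us; exact: index_enum_inj.
  + by move=> e; have := label_shared sx ts; rewrite e ltnNge label_fresh.
  + by move=> e; have := label_shared sx us; rewrite -e ltnNge label_fresh.
  rewrite !label_atom // (negbTE ts) (negbTE us) => /addnI.
  by apply: index_enum_inj; rewrite inE.
move=> _; apply/esym/eqP; rewrite -(rk_eq_top rk_rank).
by rewrite rk3 (rk_rank.2 _ _ su) s2.
Qed.

Lemma rk_coatom (u v : P) : covers u v -> covers v \top%O -> rk v = 2.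
Proof. by move=> uv /(rk_rank.2); rewrite rk3 => -[]. Qed.

(** The last label is [0], so every middle element except the one with label [0]
    gives a strict descent. *)
Lemma EL_atom_top (a : P) : a \in x -> EL_interval icov_label a \top%O.
Proof.
move=> ax; have [y0 ay0 y00] := zero_label_exists ax.
have a1 : rk a = 1 by apply/eqP; rewrite -mem_atoms.
have rk2 y : covers a y -> rk y = 2 by move/(rk_rank.2); rewrite a1.
apply: (EL_interval_diamond rk_rank ay0).
- by rewrite (coversE rk_rank) lex1 rk3 rk2.
- by rewrite y00.
move=> y ay _ ne; rewrite y00 label_top ?rk2 //.
have : icov_label a y != 0.
  apply: contraNneq ne => y_0.
  by apply/eqP/(icov_label_distinct ay ay0); rewrite y_0.
by rewrite -lt0n.
Qed.

(** The distinguished middle element is the earliest atom [a0] below [y]: for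
    any other atom [a] below [y], [y] is shared, so that its label drops below
    that of [a]. *)
Lemma EL_bot_coatom (y : P) : rk y = 2 -> EL_interval icov_label \bot%O y.
Proof.
move=> y2; pose f := find (fun b => covers b y) x.
have [c mc] := maximal_chain_exists (le0x y).
have has_f : has (fun b => covers b y) x.
  have := maximal_chain_rk rk_rank mc; rewrite rk_rank.1 y2.
  case: c mc => [|a [|z []]] // /andP[/= /and3P[a0 ay _] /eqP <-] _.
  by apply/hasP; exists a; rewrite // -covers_bot.
pose a0 := nth \bot%O x f.
have lt_f : f < size x by rewrite -has_find.
have a0x : a0 \in x by exact: mem_nth.
have a0y : covers a0 y by exact: (nth_find _ has_f).
have ia0 : index a0 x = f by rewrite index_uniq // x_atoms.1.
have P_gt0 : 0 < #|P| by apply/card_gt0P; exists y.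
apply: (EL_interval_diamond rk_rank (u0 := a0)) => //.
- by rewrite covers_bot.
- by rewrite label_bot; apply: label_fresh; rewrite // inE ia0 ltnn andbF.
move=> a; rewrite covers_bot !label_bot => ax ay ne.
have lt_fa : f < index a x.
  rewrite ltn_neqAle; apply/andP; split.
    by apply: contraNneq ne => e; rewrite /a0 e nth_index.
  rewrite leqNgt; apply/negP => /(before_find \bot%O).
  by rewrite nth_index // ay.
split; first by rewrite ia0 ltEnat /= ltn_pmul2r.
by apply: label_shared; rewrite // inE ay.
Qed.

(** An increasing chain ends with label [0], so all its labels vanish; this
    determines first the atom and then the coatom.  A word of zeros of the
    common length is lexicographically minimal. *)
Lemma EL_bot_top : EL_interval icov_label \bot%O \top%O.
Proof.
have chainE c : maximal_chain \bot%O \top%O c ->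
    exists a y, [/\ c = [:: a; y; \top%O], a \in x, covers a y & rk y = 2].
  move=> mc; have := maximal_chain_rk rk_rank mc; rewrite rk_rank.1 rk3.
  case: c mc => [|a [|y [|z []]]] // /andP[/= /and4P[a0 ay yz _] /eqP zt] _.
  rewrite zt in yz *; exists a, y; split=> //; first by rewrite -covers_bot.
  exact: rk_coatom ay yz.
have P_gt0 : 0 < #|P| by apply/card_gt0P; exists \bot%O.
have [c /chainE[a [_ [_ ax _ _]]]] := maximal_chain_exists (le0x (\top%O : P)).
pose a0 := nth a x 0.
have x_gt0 : 0 < size x.
  by apply: leq_ltn_trans (_ : index a x < _); rewrite ?index_mem.
have a0x : a0 \in x by exact: mem_nth.
have ia0 : index a0 x = 0 by rewrite index_uniq // x_atoms.1.
have [y0 ay0 y00] := zero_label_exists a0x.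
have y02 : rk y0 = 2.
  by move: a0x; rewrite mem_atoms (rk_rank.2 _ _ ay0) => /eqP ->.
have word0 : label_word icov_label \bot%O [:: a0; y0; \top%O] = [:: 0; 0; 0].
  by rewrite /label_word /= label_bot ia0 y00 label_top.
exists [:: a0; y0; \top%O]; split.
- rewrite /maximal_chain /= covers_bot a0x ay0 eqxx (coversE rk_rank) lex1 rk3.
  by rewrite y02.
- by rewrite /increasing_chain word0.
- move=> _ /chainE[b [y [-> bx iby y2]]].
  rewrite /increasing_chain /label_word /= label_bot label_top // andbT.
  rewrite !leEnat leqn0.
  case/andP=> le_b /eqP by0.
  move: le_b; rewrite by0 leqn0 muln_eq0 -(leqn0 #|P|) leqNgt P_gt0 orbF.
  move/eqP=> ib.
  have ba : b = a0 by rewrite -(nth_index a bx) ib.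
  by rewrite ba in iby by0 *; rewrite (icov_label_distinct iby ay0) // by0.
move=> _ /chainE[b [y [-> _ _ _]]].
by rewrite word0 /label_word /= !lexi_cons !leEnat !leq0n !implybT.
Qed.

Lemma icov_label_EL : EL_labeling icov_label.
Proof.
move=> s t st; change (EL_interval icov_label s t).
have [c mc] := maximal_chain_exists st.
have rkt := maximal_chain_rk rk_rank mc.
have [-> | s_neq0] := eqVneq s \bot%O.
  have := rk_le rk_rank (lex1 t); rewrite rk3.
  case t_rk: (rk t) => [|[|[|[|]]]] // _.
  - move/eqP: t_rk; rewrite (rk_eq0 rk_rank) => /eqP ->.
    exact: (EL_interval_refl _ rk_rank).
  - by apply: (EL_interval_cover _ rk_rank); rewrite covers_bot mem_atoms t_rk.
  - exact: EL_bot_coatom.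
  move/eqP: t_rk; rewrite -rk3 (rk_eq_top rk_rank) => /eqP ->.
  exact: EL_bot_top.
case: c mc rkt => [/eqP <- _ | u [/andP[/= /andP[su _] /eqP <-] _ | v c mc rkt]].
- exact: (EL_interval_refl _ rk_rank).
- exact: (EL_interval_cover _ rk_rank).
have := rk_le rk_rank (lex1 t); move: s_neq0; rewrite rk3 -(rk_eq0 rk_rank).
case s_rk: (rk s) rkt => [|[|m]] //= rkt _; last by rewrite rkt !addnS.
rewrite rkt !addnS !ltnS leqn0 => /eqP c0.
have /eqP -> : t == \top%O by rewrite -(rk_eq_top rk_rank) rk3 rkt !addnS c0.
by apply: EL_atom_top; rewrite mem_atoms s_rk.
Qed.

(** At the bottom, [des] of an atom is the size of its shared set and [Ind] is
    strictly increasing along the ordering.  At an atom, [des] is [0] or [1]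
    according to whether the label vanishes, and the vanishing label is the one
    of smallest [Ind]. *)
Lemma icov_label_des_mono (s s' t t' : P) :
  rk s = rk s' -> covers s t -> covers s' t' ->
  Ind icov_label s t <= Ind icov_label s' t' ->
  des icov_label s t <= des icov_label s' t'.
Proof.
move=> rk_s st st'.
have dist := icov_label_distinct.
rewrite !(IndE dist) // !(desE dist) ltnS.
have [[s0 tx]|[sx t2]|[s2 ->]] := covers_cases st.
- have s0' : s' = \bot%O.
    by apply/eqP; rewrite -(rk_eq0 rk_rank) -rk_s s0 rk_rank.1.
  rewrite {}s0 {}s0' in st st' * => le_Ind.
  have tx' : t' \in x by rewrite -covers_bot.
  have desE a : a \in x ->
      [set u | covers a u & (icov_label a u < icov_label \bot a)%O] = shared a.
    move=> ax; apply/setP=> u; rewrite inE label_bot ltEnat /= label_lt //.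
    by rewrite andb_idl // inE => /andP[].
  rewrite !desE //; apply: shared_mono => //; rewrite leqNgt; apply/negP => lt_idx.
  move: le_Ind; rewrite leqNgt => /negP; apply; apply: proper_card.
  have P_gt0 : 0 < #|P| by apply/card_gt0P; exists t.
  have lt_lab : icov_label \bot%O t' < icov_label \bot%O t.
    by rewrite !label_bot ltn_pmul2r.
  apply/properP; split; last by exists t'; rewrite !inE ?ltxx ?andbF // st' ltEnat.
  apply/subsetP=> u; rewrite !inE => /andP[-> /=] lt_u; exact: lt_trans lt_u lt_lab.
- have sx' : s' \in x by rewrite mem_atoms -rk_s -mem_atoms.
  have t2' : rk t' = 2.
    by move: sx'; rewrite mem_atoms (rk_rank.2 _ _ st') => /eqP ->.
  have top y : rk y = 2 -> [set u | covers y u] = [set \top%O].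
    move=> y2; apply/setP=> u; rewrite !inE -(rk_eq_top rk_rank) (coversE rk_rank) rk3 y2.
    apply: andb_idl; rewrite -rk3 (rk_eq_top rk_rank) => /eqP ->; exact: lex1.
  have [l0 | l_gt0] := posnP (icov_label s' t') => le_Ind.
    (* No label above [s'] is smaller than [0], so none above [s] is smaller
       than that of [t], which must be the zero label. *)
    have [y sy y0] := zero_label_exists sx.
    have t0 : icov_label s t = 0.
      apply/eqP; rewrite -leqn0 leqNgt; apply/negP => t_gt0; move: le_Ind.
      rewrite l0 [X in _ <= X]eq_card0; last first.
        by move=> u; rewrite !inE ltEnat /= ltn0 andbF.
      rewrite leqn0 cards_eq0 => /eqP/setP/(_ y).
      by rewrite !inE sy y0 ltEnat /= t_gt0.
    by rewrite t0 eq_card0 // => u; rewrite !inE ltEnat /= ltn0 andbF.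
  apply: (@leq_trans 1).
    rewrite -(cards1 (\top%O : P)) -(top _ t2); apply: subset_leq_card.
    by apply/subsetP=> u; rewrite !inE => /andP[].
  apply/card_gt0P; exists \top%O; have /setP/(_ \top%O) := top _ t2'.
  by rewrite !inE eqxx => ->; rewrite label_top.
move=> _; rewrite eq_card0 // => u; rewrite !inE.
by apply/negP => /andP[/andP[/lt_geF]]; rewrite lex1.
Qed.

End Labeling.

Theorem theorem6p4 (d : Order.disp_t) (P : finTBPOrderType d) (rk : P -> nat)
    (rk_rank : is_rank_function rk)
    (rk3 : rk (\top)%O = 3)
    (P_uniform : rank_uniform rk)
    (n : nat) (x : n.-tuple P)
    (x_atoms : is_atom_ordering rk x)
    (icov_x2_gt0 : forall i : 'I_n, i = 1 :> nat -> 0 < #|icov rk x i|)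
    (icov_le : forall i j : 'I_n, 0 < i -> i <= j ->
                 #|icov rk x i| <= #|icov rk x j|) :
  UMEL_shellable rk.
Proof.
exists _, nat, (icov_label x); apply: uniform_monotonic.
- exact: icov_label_distinct x_atoms.
- exact: icov_label_EL x_atoms icov_x2_gt0 icov_le.
- by move=> s s' rk_s; rewrite !(card_covers rk_rank); apply: P_uniform.
exact: icov_label_des_mono x_atoms icov_x2_gt0 icov_le.
Qed.
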